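(* Let $\gamma_- < \gamma_+$ be real constants, let $f$ be a function, not identically zero, that is $C^1$ on $[\gamma_-,\gamma_+]$ and satisfies $f(\gamma_-)=f(\gamma_+)=0$, let $F$ be a function with $F'=f$, and suppose the initial datum satisfies $\gamma_-\le \phi_0\le \gamma_+$. Suppose the time step $\Delta t>0$ satisfies $$\Delta t \max_{\gamma_-\le u\le \gamma_+} f'(u)\le 1 .$$ Let $(\phi_j^n)_{1\le j\le J,\ n\ge 0}$ be the solution of the semi-implicit scheme $$\frac{\phi_j^{n+1}-\phi_j^n}{\Delta t}=\varepsilon^2\nabla_+\nabla_-\phi_j^{n+1}-f(\phi_j^n),\qquad 1\le j\le J,\ n\ge 0,$$ with periodic boundary conditions and initial values $\phi_j^0=\phi_0(x_j)$. Define the discrete energy $$E_h(\phi^n)=\frac{\varepsilon^2}{2}\sum_{j=1}^J(\nabla_+\phi_j^n)^2\,\Delta x+\sum_{j=1}^J F(\phi_j^n)\,\Delta x .$$ Then $$E_h(\phi^{n+1})\le E_h(\phi^n)\qquad\text{for all } n\ge 0 .$$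
   Context: The scheme discretizes the Allen-Cahn equation $\partial_t\phi=\varepsilon^2\Delta\phi-f(\phi)$, $\phi(x,0)=\phi_0(x)$, in one space dimension, with potential $F$ and $f=F'$. Here $\varepsilon>0$ is a constant, $J\ge 1$ is the number of spatial grid points $x_1,\dots,x_J$ of a uniform grid with mesh size $\Delta x>0$, and $\Delta t>0$ is the time step; all quantities are real. The difference operators are $$\nabla_+u_j=\frac{u_{j+1}-u_j}{\Delta x},\qquad \nabla_-u_j=\frac{u_j-u_{j-1}}{\Delta x}.$$ Periodic boundary conditions mean that indices are understood modulo $J$, i.e. $\phi_0^n=\phi_J^n$ and $\phi_{J+1}^n=\phi_1^n$ (here $\phi_0^n$ is the grid value with index $0$, not the initial function $\phi_0$). The relation $F'=f$ is required on $[\gamma_-,\gamma_+]$; derivatives at the endpoints of $[\gamma_-,\gamma_+]$ are one-sided if the functions are defined only on that interval, and values of $f$ and $F$ outside the interval play no role in the hypotheses. *)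

(* Defs.v *)
From HB Require Import structures.
From mathcomp Require Import all_boot all_order all_algebra.
From mathcomp Require Import all_classical all_reals all_analysis.

Set Implicit Arguments.
Unset Strict Implicit.
Unset Printing Implicit Defensive.

Import Order.TTheory GRing.Theory Num.Theory.
Import numFieldNormedType.Exports.

Local Open Scope classical_set_scope.
Local Open Scope ring_scope.

(* Derivative of the restriction of f to A: at an endpoint of an interval
   [a, b] with a < b this is the one-sided derivative, in its interior the
   usual one. Values of f outside A are irrelevant for u in A. *)
Definition diff_quotient (R : realType) (f : R -> R) (u v : R) : R :=
  (f v - f u) / (v - u).

Definition derivable1_within (R : realType) (A : set R) (f : R -> R) (u : R) :
  Prop := cvg (diff_quotient f u @ within A u^').

Definition derive1_within (R : realType) (A : set R) (f : R -> R) (u : R) : R :=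
  lim (diff_quotient f u @ within A u^').

Definition C1_within (R : realType) (A : set R) (f : R -> R) : Prop :=
  (forall u, A u -> derivable1_within A f u) /\
  {within A, continuous (derive1_within A f)}.

Definition antiderivative_within (R : realType) (A : set R) (F f : R -> R) :
  Prop :=
  forall u, A u -> derivable1_within A F u /\ derive1_within A F u = f u.

(* Grid functions are indexed by 'I_J, index j standing for the (j+1)-st grid
   point; ordS and ord_pred are the cyclic successor and predecessor, so the
   difference operators are the periodic ones. *)
Definition grid_point (R : realType) (J : nat) (x1 dx : R) (j : 'I_J) : R :=
  x1 + (j : nat)%:R * dx.

Definition fwd_diff (R : realType) (J : nat) (dx : R) (u : 'I_J -> R)
    (j : 'I_J) : R :=
  (u (ordS j) - u j) / dx.

Definition bwd_diff (R : realType) (J : nat) (dx : R) (u : 'I_J -> R)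
    (j : 'I_J) : R :=
  (u j - u (ord_pred j)) / dx.

Definition semi_implicit_scheme (R : realType) (J : nat) (eps dx dt : R)
    (f : R -> R) (phi : nat -> 'I_J -> R) : Prop :=
  forall (n : nat) (j : 'I_J),
    (phi n.+1 j - phi n j) / dt
    = eps ^+ 2 * fwd_diff dx (bwd_diff dx (phi n.+1)) j - f (phi n j).

Definition discrete_energy (R : realType) (J : nat) (eps dx : R) (F : R -> R)
    (u : 'I_J -> R) : R :=
  eps ^+ 2 / 2 * (\sum_(j < J) fwd_diff dx u j ^+ 2 * dx)
  + \sum_(j < J) F (u j) * dx.

(* Main.v *)
Require Import Defs.
From HB Require Import structures.
From mathcomp Require Import all_boot all_order all_algebra.
From mathcomp Require Import all_classical all_reals all_analysis.
From mathcomp Require Import ring lra.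

Set Implicit Arguments.
Unset Strict Implicit.
Unset Printing Implicit Defensive.

Import Order.TTheory GRing.Theory Num.Theory.
Import numFieldNormedType.Exports.

Local Open Scope classical_set_scope.
Local Open Scope ring_scope.

(** The step restriction makes u - dt f(u) nondecreasing on [gm, gp] (mean value
    theorem, with dt f' <= 1 there; C1_within_slope_le), and this monotonicity
    is used twice.

    It gives a maximum principle (semi_implicit_scheme_itv).  The scheme reads
    v - dt eps^2 D+D- v = u - dt f(u), with u the old and v the new time level.
    Where v is largest, D+D- v <= 0, so that v <= u - dt f(u) <= gp - dt f(gp)
    = gp there; likewise v >= gm where v is smallest.  By induction all grid
    values stay in [gm, gp], where F and f are controlled.

    It also bounds the potential (potential_increment_le): F v - F u =
    f c (v - u) for some c between u and v, and replacing f c by f u costs at most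
    |c - u| |v - u| / dt, so F v - F u <= f u (v - u) + (v - u)^2 / dt.  The
    quadratic term is twice the one in Taylor's inequality, but the scheme
    dissipates exactly this much, so no sharper estimate is called for.

    Finally, multiply the scheme by w = v - u and sum.  Convexity of the square
    and summation by parts bound the change of the gradient energy by
    - eps^2 \sum (D+D- v) w dx, and the potential changes by at most
    \sum (f(u) w + w^2 / dt) dx.  By the scheme the two bounds add up to 0. *)

(** * Differentiation relative to an interval *)

(** Away from u, f v - f u is the difference quotient, which converges, times
    v - u, which tends to 0. *)
Lemma derivable1_within_continuous (R : realType) (A : set R) (f : R -> R) :
  (forall u, A u -> derivable1_within A f u) -> {within A, continuous f}.
Proof.
move=> df; apply/subspace_continuousP => u Au.
have dq := df u Au; set l := lim (diff_quotient f u @ within A u^') in dq.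
have id0 : (fun v => v - u) @ within A u^' --> (0 : R).
  rewrite -(subrr u); apply: cvgB; last exact: cvg_cst.
  by move=> P uP; apply: filterS uP => v + _.
have : (fun v => f u + diff_quotient f u v * (v - u)) @ within A u^' --> f u.
  rewrite -[X in _ --> X]addr0 -(mulr0 l).
  by apply: cvgD; [exact: cvg_cst|exact: cvgM].
move=> fu; apply/cvgrPdist_lt => e e0.
have {fu} : \forall v \near u, v != u -> A v ->
    `|f u - (f u + diff_quotient f u v * (v - u))| < e.
  by move/cvgrPdist_lt/(_ _ e0) : fu.
rewrite near_withinE; apply: filterS => v uv Av.
have [->|vu] := eqVneq v u; first by rewrite subrr normr0.
by move: (uv vu Av); rewrite /diff_quotient divfK ?subr_eq0// subrKC.
Qed.

(** In a neighbourhood of an interior point the restriction to A is invisible;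
    what remains is the translation from v near u to h = v - u near 0. *)
Lemma derive1_within_is_derive (R : realType) (A : set R) (f : R -> R) (u : R) :
  nbhs u A -> derivable1_within A f u ->
  is_derive u 1 f (derive1_within A f u).
Proof.
move=> nA df.
suff H : (fun h => h^-1 *: ((f \o shift u) (h *: (1 : R)) - f u)) @ 0^' -->
    derive1_within A f u.
  by split; [apply/cvg_ex; eexists; exact: H | exact/cvg_lim].
have {}df : diff_quotient f u @ within A u^' --> derive1_within A f u by [].
apply/cvgrPdist_lt => e e0.
have {nA df} : \forall v \near u, v != u ->
    `|derive1_within A f u - diff_quotient f u v| < e.
  have : \forall v \near u, v != u -> A v ->
      `|derive1_within A f u - diff_quotient f u v| < e.
    by move/cvgrPdist_lt/(_ _ e0) : df.
  by apply: filterS2 nA => v Av uv vu; exact: uv.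
move=> /nbhs0P uv; rewrite near_withinE; apply: filterS uv => h uv h0.
rewrite /= -[h *: 1]/(h * 1) mulr1 (addrC h) -[_ *: _]/(_ * _) mulrC.
have := uv _; rewrite /diff_quotient (addrC u h) addrK (addrC h u).
by apply; apply: contraNneq h0 => uhu; apply/eqP; lra.
Qed.

(** One-sided derivatives at gm and gp suffice: the mean value theorem asks for
    differentiability only inside [x, y], and there the derivative relative to
    [gm, gp] is the usual one. *)
Lemma MVT_within (R : realType) (gm gp : R) (f : R -> R) :
  (forall u, u \in `[gm, gp] -> derivable1_within `[gm, gp] f u) ->
  forall x y, x \in `[gm, gp] -> y \in `[gm, gp] -> x <= y ->
  exists2 c, c \in `[x, y] &
    f y - f x = derive1_within `[gm, gp] f c * (y - x).
Proof.
move=> df x y; rewrite !in_itv/= => /andP[gx xg] /andP[gy yg] xy.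
have sub : `[x, y] `<=` `[gm, gp].
  move=> z /=; rewrite !in_itv/= => /andP[xz zy].
  by rewrite (le_trans gx xz) (le_trans zy yg).
apply: (MVT_segment xy) => [z zxy|].
  apply: derive1_within_is_derive.
    apply: filterS (near_in_itvoo zxy) => v vxy; apply: sub.
    exact: subset_itv_oo_cc.
  by apply/df/sub; apply: subset_itv_oo_cc.
by apply: continuous_subspaceW sub _; exact: derivable1_within_continuous.
Qed.

(** The derivative is continuous on a compact interval, so its set of values is
    bounded and the supremum really bounds it (sup is 0 on unbounded sets). *)
Lemma C1_within_slope_le (R : realType) (gm gp : R) (f : R -> R) :
  gm <= gp -> C1_within `[gm, gp] f ->
  forall x y, x \in `[gm, gp] -> y \in `[gm, gp] -> x <= y ->
  f y - f x <= sup (derive1_within `[gm, gp] f @` `[gm, gp]) * (y - x).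
Proof.
move=> gmp [df cdf] x y xg yg xy.
have [c cxy ->] := MVT_within df xg yg xy.
apply: ler_wpM2r; first by rewrite subr_ge0.
apply: ub_le_sup; last first.
  exists c => //=; move: cxy xg yg.
  rewrite !in_itv/= => /andP[xc cy] /andP[gx _] /andP[_ yg].
  by rewrite (le_trans gx xc) (le_trans cy yg).
have [d _ dmax] := EVT_max gmp cdf.
by exists (derive1_within `[gm, gp] f d) => _ [z /= zg <-]; exact: dmax.
Qed.

(** * Consequences of the time step restriction *)

(** With c the mean value point, the gap between the two sides is
    (v - u) ((v - u) - dt (f c - f u)) / dt.  If u <= v both factors are
    nonnegative, as dt (f c - f u) <= c - u <= v - u; if v <= u both are
    nonpositive, by the same estimate from c up to u. *)
Lemma potential_increment_le (R : realType) (gm gp dt : R) (f F : R -> R) :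
  0 < dt -> antiderivative_within `[gm, gp] F f ->
  (forall x y, x \in `[gm, gp] -> y \in `[gm, gp] -> x <= y ->
    dt * (f y - f x) <= y - x) ->
  forall u v, u \in `[gm, gp] -> v \in `[gm, gp] ->
  F v - F u <= f u * (v - u) + (v - u) ^+ 2 / dt.
Proof.
move=> dt0 hF hf u v ug vg.
have dF w : w \in `[gm, gp] -> derivable1_within `[gm, gp] F w.
  by move=> /hF[].
have sub x y c : x \in `[gm, gp] -> y \in `[gm, gp] -> c \in `[x, y] ->
    c \in `[gm, gp].
  rewrite !in_itv/= => /andP[gx _] /andP[_ yg] /andP[xc cy].
  by rewrite (le_trans gx xc) (le_trans cy yg).
rewrite -subr_ge0 -(pmulr_rge0 _ dt0).
have [uv|/ltW vu] := leP u v.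
- have [c cuv] := MVT_within dF ug vg uv.
  have cg := sub _ _ _ ug vg cuv; rewrite (hF c cg).2 => ->.
  move: cuv; rewrite in_itv/= => /andP[uc cv].
  have fuc := hf _ _ ug cg uc.
  rewrite (_ : dt * _ = (v - u) * ((v - u) - dt * (f c - f u))); last first.
    by field; rewrite gt_eqF.
  by apply: mulr_ge0; lra.
- have [c cvu] := MVT_within dF vg ug vu.
  have cg := sub _ _ _ vg ug cvu; rewrite (hF c cg).2 => Fuv.
  move: cvu; rewrite in_itv/= => /andP[vc cu].
  have fcu := hf _ _ cg ug cu.
  rewrite -(opprB (F u)) Fuv.
  rewrite (_ : dt * _ = (u - v) * ((u - v) - dt * (f u - f c))); last first.
    by field; rewrite gt_eqF.
  by apply: mulr_ge0; lra.
Qed.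

(** * Periodic difference operators *)

Lemma bwd_diff_ordS (R : realType) (J : nat) (dx : R) (u : 'I_J -> R) j :
  bwd_diff dx u (ordS j) = fwd_diff dx u j.
Proof. by rewrite /bwd_diff ordSK. Qed.

(** Shifting the index by one permutes a periodic grid; hence the two difference
    operators are adjoint up to sign. *)
Lemma sum_fwd_diff_mulr (R : realType) (J : nat) (dx : R) (p w : 'I_J -> R) :
  \sum_j fwd_diff dx p j * w j = - \sum_j p j * bwd_diff dx w j.
Proof.
have -> : \sum_j fwd_diff dx p j * w j =
    \sum_j p (ordS j) * w j / dx - \sum_j p j * w j / dx.
  by rewrite -sumrB; apply: eq_bigr => j _; rewrite /fwd_diff; ring.
rewrite [X in _ = - X](_ : _ =
    \sum_j p j * w j / dx - \sum_j p j * w (ord_pred j) / dx); last first.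
  by rewrite -sumrB; apply: eq_bigr => j _; rewrite /bwd_diff; ring.
rewrite opprB; congr (_ - _).
rewrite [RHS](reindex_inj (@ordS_inj J)).
by apply: eq_bigr => j _; rewrite ordSK.
Qed.

(** Discrete Green identity: forward differences are backward differences
    shifted by one, so this is summation by parts for the backward difference
    of v.  Periodicity leaves no boundary terms. *)
Lemma sum_fwd_diff_mul (R : realType) (J : nat) (dx : R) (v w : 'I_J -> R) :
  \sum_j fwd_diff dx v j * fwd_diff dx w j =
  - \sum_j fwd_diff dx (bwd_diff dx v) j * w j.
Proof.
rewrite (sum_fwd_diff_mulr dx (bwd_diff dx v)) opprK.
rewrite [RHS](reindex_inj (@ordS_inj J)).
by apply: eq_bigr => j _; rewrite !bwd_diff_ordS.
Qed.

Lemma fwd_bwd_diff_argmax_le0 (R : realType) (J : nat) (dx : R)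
    (v : 'I_J -> R) (i : 'I_J) :
  (forall j, v j <= v i) -> fwd_diff dx (bwd_diff dx v) i <= 0.
Proof.
move=> vi; rewrite /fwd_diff bwd_diff_ordS /fwd_diff /bwd_diff.
rewrite (_ : _ / dx = ((v (ordS i) - v i) + (v (ord_pred i) - v i)) * dx^-1 ^+ 2).
  apply: mulr_le0_ge0; last exact: sqr_ge0.
  by have := vi (ordS i); have := vi (ord_pred i); lra.
by ring.
Qed.

(** Maximum principle for one implicit diffusion step: where v is largest its
    second difference is nonpositive, so there v is at most the right-hand
    side. *)
Lemma implicit_diffusion_le (R : realType) (J : nat) (k dx c : R)
    (v : 'I_J -> R) : 0 <= k ->
  (forall j, v j - k * fwd_diff dx (bwd_diff dx v) j <= c) ->
  forall j, v j <= c.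
Proof.
move=> k0 vc j.
pose i := [arg max_(i > j) v i]%O.
have vi l : v l <= v i by rewrite /i; case: arg_maxP => // m _; exact.
apply: (le_trans (vi j)); apply: le_trans (vc i).
by rewrite lerBrDr gerDl mulr_ge0_le0// fwd_bwd_diff_argmax_le0.
Qed.

Lemma implicit_diffusion_ge (R : realType) (J : nat) (k dx c : R)
    (v : 'I_J -> R) : 0 <= k ->
  (forall j, c <= v j - k * fwd_diff dx (bwd_diff dx v) j) ->
  forall j, c <= v j.
Proof.
move=> k0 vc j; rewrite -lerN2.
apply: (@implicit_diffusion_le _ _ k dx _ (fun j => - v j)) k0 _ j => j.
have := vc j; rewrite -lerN2; apply: le_trans; rewrite le_eqVlt; apply/predU1P.
by left; rewrite /fwd_diff /bwd_diff; ring.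
Qed.

(** * The semi-implicit scheme *)

(** The zeros gm and gp of f are fixed by the nondecreasing map u - dt f(u), which
    therefore sends [gm, gp] into itself; the implicit diffusion step that
    follows preserves bounds. *)
Lemma semi_implicit_scheme_itv (R : realType) (J : nat) (eps dx dt gm gp : R)
    (f : R -> R) (phi : nat -> 'I_J -> R) :
  0 < dt -> gm <= gp -> f gm = 0 -> f gp = 0 ->
  (forall x y, x \in `[gm, gp] -> y \in `[gm, gp] -> x <= y ->
    dt * (f y - f x) <= y - x) ->
  semi_implicit_scheme eps dx dt f phi ->
  (forall j, phi 0%N j \in `[gm, gp]) ->
  forall n j, phi n j \in `[gm, gp].
Proof.
move=> dt0 gmp fm fp hf hs h0; elim=> [//|n IHn] j.
have gmI : gm \in `[gm, gp] by rewrite in_itv/= lexx.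
have gpI : gp \in `[gm, gp] by rewrite in_itv/= lexx andbT.
have k0 : 0 <= dt * eps ^+ 2 by rewrite mulr_ge0 ?sqr_ge0// ltW.
have step i : phi n.+1 i
    - dt * eps ^+ 2 * fwd_diff dx (bwd_diff dx (phi n.+1)) i
    = phi n i - dt * f (phi n i).
  have /(congr1 (fun z => dt * z)) := hs n i.
  by rewrite [dt * (_ / _)]mulrC divfK ?gt_eqF// mulrBr mulrA => H; lra.
rewrite in_itv/=; apply/andP; split.
- apply: (implicit_diffusion_ge (dx := dx) k0) => i; rewrite step.
  have := IHn i; rewrite in_itv/= => /andP[gi _].
  by have := hf _ _ gmI (IHn i) gi; rewrite fm; lra.
- apply: (implicit_diffusion_le (dx := dx) k0) => i; rewrite step.
  have := IHn i; rewrite in_itv/= => /andP[_ gi].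
  by have := hf _ _ (IHn i) gpI gi; rewrite fp; lra.
Qed.

Theorem theorem3p1 (R : realType) (eps dx dt gm gp x1 : R) (J : nat)
    (f F phi0 : R -> R) (phi : nat -> 'I_J -> R)
    (heps : 0 < eps) (hJ : (1 <= J)%N) (hdx : 0 < dx) (hdt : 0 < dt)
    (hg : gm < gp)
    (hf_neq0 : exists2 u, u \in `[gm, gp] & f u != 0)
    (hf_C1 : C1_within `[gm, gp] f)
    (hf_gm : f gm = 0) (hf_gp : f gp = 0)
    (hF : antiderivative_within `[gm, gp] F f)
    (hphi0 : forall x : R, gm <= phi0 x <= gp)
    (hstep : dt * sup (derive1_within `[gm, gp] f @` `[gm, gp]) <= 1)
    (hscheme : semi_implicit_scheme eps dx dt f phi)
    (hinit : forall j : 'I_J, phi 0%N j = phi0 (grid_point x1 dx j)) :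
  forall n : nat,
    discrete_energy eps dx F (phi n.+1) <= discrete_energy eps dx F (phi n).
Proof.
move=> n.
have hf x y : x \in `[gm, gp] -> y \in `[gm, gp] -> x <= y ->
    dt * (f y - f x) <= y - x.
  move=> xg yg xy; have yx0 : 0 <= y - x by rewrite subr_ge0.
  have := C1_within_slope_le (ltW hg) hf_C1 xg yg xy.
  rewrite -(ler_pM2l hdt) => /le_trans; apply.
  by rewrite mulrA -[leRHS]mul1r ler_wpM2r.
have phig : forall m j, phi m j \in `[gm, gp].
  apply: semi_implicit_scheme_itv (ltW hg) hf_gm hf_gp hf hscheme _ => //.
  by move=> j; rewrite hinit in_itv/= hphi0.
pose u := phi n; pose v := phi n.+1; pose w j := v j - u j.
have grad : eps ^+ 2 / 2 * (\sum_(j < J) fwd_diff dx v j ^+ 2 * dx)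
    - eps ^+ 2 / 2 * (\sum_(j < J) fwd_diff dx u j ^+ 2 * dx)
    <= - \sum_j eps ^+ 2 * fwd_diff dx (bwd_diff dx v) j * w j * dx.
  rewrite [leRHS](_ : _ = eps ^+ 2 * dx *
      (\sum_j fwd_diff dx v j * fwd_diff dx w j)); last first.
    rewrite sum_fwd_diff_mul mulrN mulr_sumr; congr (- _).
    by apply: eq_bigr => j _; ring.
  rewrite !mulr_sumr -sumrB; apply: ler_sum => j _.
  (* a^2 - b^2 <= 2 a (a - b): the square lies above its tangent at a *)
  rewrite -subr_ge0 (_ : _ - _ =
      eps ^+ 2 * dx * (fwd_diff dx v j - fwd_diff dx u j) ^+ 2 / 2).
    apply: divr_ge0 => //; apply: mulr_ge0; last exact: sqr_ge0.
    by apply: mulr_ge0; [exact: sqr_ge0 | exact: ltW].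
  by rewrite /fwd_diff /w; field; rewrite gt_eqF.
have pot : \sum_(j < J) F (v j) * dx - \sum_(j < J) F (u j) * dx
    <= \sum_j (f (u j) * w j + w j ^+ 2 / dt) * dx.
  rewrite -sumrB; apply: ler_sum => j _; rewrite -mulrBl ler_wpM2r ?(ltW hdx)//.
  exact: potential_increment_le hdt hF hf _ _ (phig n j) (phig n.+1 j).
(* multiplying the scheme by w turns the time derivative into w^2 / dt *)
have balance : \sum_j (f (u j) * w j + w j ^+ 2 / dt) * dx =
    \sum_j eps ^+ 2 * fwd_diff dx (bwd_diff dx v) j * w j * dx.
  apply: eq_bigr => j _; have := hscheme n j; rewrite -/u -/v => hj.
  have -> : w j ^+ 2 / dt = w j * ((v j - u j) / dt) by rewrite /w; ring.
  by rewrite hj; ring.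
rewrite /discrete_energy -/u -/v; rewrite balance in pot.
lra.
Qed.
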